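(* Every red--blue coloring of the edges of $K_{10}$ with no monochromatic $C_8$ contains a monochromatic Hamilton-connected subgraph on seven vertices.
   Context: $C_8$ is the cycle on $8$ vertices; subgraphs need not be induced. A graph is Hamilton-connected if every two distinct vertices are the endpoints of a spanning path. A subgraph is monochromatic if all its edges have the same color. *)

(* Defs.v *)
From mathcomp Require Import all_boot.

Set Implicit Arguments.
Unset Strict Implicit.
Unset Printing Implicit Defensive.

(* Simple graphs whose vertices lie in an ambient finite type T; edges are
   2-element sets of vertices, so loops and multiple edges are excluded. *)
Record graph (T : finType) := Graph {
  vertices : {set T};
  edges : {set {set T}};
  edgesP : forall e, e \in edges -> (#|e| == 2) && (e \subset vertices)
}.

Definition adj (T : finType) (G : graph T) : rel T :=
  fun x y => [set x; y] \in edges G.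

Definition subgraph (T : finType) (H G : graph T) : Prop :=
  (vertices H \subset vertices G) /\ (edges H \subset edges G).

Definition isomorphic (T U : finType) (G : graph T) (H : graph U) : Prop :=
  exists f : T -> U,
    [/\ {in vertices G &, injective f},
        f @: vertices G = vertices H
      & [set f @: e | e : {set T} in edges G] = edges H].

Lemma complete_edgesP (n : nat) (e : {set 'I_n}) :
  e \in [set e : {set 'I_n} | #|e| == 2] ->
  (#|e| == 2) && (e \subset [set: 'I_n]).
Proof. by rewrite inE subsetT andbT. Qed.

Definition complete_graph (n : nat) : graph 'I_n :=
  Graph (@complete_edgesP n).

(* [ordS i] is i + 1 mod n. The cardinality test only matters for n = 1, where
   it discards the degenerate pair [set i; i]. *)
Definition cycle_edges (n : nat) : {set {set 'I_n}} :=
  [set e : {set 'I_n} | (#|e| == 2) && [exists i, e == [set i; ordS i]]].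

Lemma cycle_edgesP (n : nat) (e : {set 'I_n}) :
  e \in cycle_edges n -> (#|e| == 2) && (e \subset [set: 'I_n]).
Proof. by rewrite inE subsetT andbT => /andP[]. Qed.

Definition cycle_graph (n : nat) : graph 'I_n := Graph (@cycle_edgesP n).

(* The two colors are the two booleans. A coloring is given on all sets of
   vertices, but only its values on edges are ever used. *)
Definition coloring (T : finType) := {set T} -> bool.

Definition monochromatic (T : finType) (c : coloring T) (H : graph T) : Prop :=
  exists k : bool, forall e, e \in edges H -> c e = k.

Definition spanning_path (T : finType) (G : graph T) (x y : T) (p : seq T) :
    Prop :=
  [/\ path (adj G) x p, last x p = y, uniq (x :: p)
    & x :: p =i vertices G].

Definition hamilton_connected (T : finType) (G : graph T) : Prop :=
  forall x y, x \in vertices G -> y \in vertices G -> x != y ->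
  exists p : seq T, spanning_path G x y p.

(* Main.v *)
Require Import Defs.
From mathcomp Require Import all_boot.

Set Implicit Arguments.
Unset Strict Implicit.
Unset Printing Implicit Defensive.

(** A long monochromatic cycle is grown step by step, and each step is a small
    finite problem.

    Some five edges at a vertex have the same color, and a coloring containing
    such a star has a monochromatic C_6 (lemma [has_cycle6]). A monochromatic
    C_6 forces, among ten vertices, a monochromatic C_7 or C_8
    ([cycle7_of_cycle6]). It remains to start from a C_7, say red, with vertex
    set X, and to find a monochromatic C_8 or Hamilton-connected subgraph on
    seven vertices.

    If one of the three vertices outside X has two red neighbors in X
    ([outcome_of_chord]), then either these are consecutive on the cycle and
    give a red C_8, or rerouting the cycle through the outer vertex shows that
    many edges must be blue. Otherwise each of the three outer vertices is blue
    to all of X but at most one vertex ([outcome_of_far]): the blue graph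
    contains almost all of K_{7,3}, in which the longest cycles have length 6.
    Two more blue edges inside X generally prolong such a cycle to a blue C_8,
    so that X is nearly a red clique, hence Hamilton-connected.

    Each of these four facts says that every extension of a known partial
    coloring contains a wanted subgraph, and is proved by a search that colors
    one edge after the other in both ways ([search_sound]). A branch stops as
    soon as the edge just colored closes a monochromatic cycle of a wanted
    length, or seven vertices are found whose minimum degree in one color is at
    least 4 and any two of which are joined by a spanning path of that color.
    Since each step fixes the cycle found before by a choice of labels, the
    searches visit at most a few thousand partial colorings each. *)

(** * Partial colorings as adjacency tables *)

Definition table := seq bitseq.

Definition row (g : table) (u : nat) : bitseq := nth [::] g u.

Definition put (b : bool) (r : bitseq) (v : nat) : bitseq :=
  set_nth false r v b.

Definition insert (g : table) (u v : nat) : table :=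
  let g' := set_nth [::] g u (put true (row g u) v) in
  set_nth [::] g' v (put true (row g' v) u).

(** A partial coloring of the complete graph: the table of the edges known to
    have color [true], and the table of those known to have color [false]. *)
Definition state := (table * table)%type.

Definition side (st : state) (b : bool) : table := if b then st.1 else st.2.

Definition add (st : state) (b : bool) (u v : nat) : state :=
  if b then (insert st.1 u v, st.2) else (st.1, insert st.2 u v).

(** Missing rows and missing entries of a row read as [false]. *)
Definition blank : state := ([::], [::]).

(* Here and in [pick] and [search], conditionals replace the boolean
   connectives: evaluation by value would compute both arguments of a
   disjunction. *)
Fixpoint meet (r s t : bitseq) : bool :=
  match r, s, t with
  | a :: r', b :: s', c :: t' =>
    if (if a then if b then c else false else false) then true
    else meet r' s' t'
  | _, _, _ => false
  end.

(** Tries [f] on each vertex selected by both [r] and [free], after striking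
    that vertex off [free]; [pre] is the reversed part of [free] already
    scanned.  Scanning the three lists in parallel avoids all indexing. *)
Fixpoint pick (f : bitseq -> bitseq -> bool) (pre r free : bitseq) (g : table) :
    bool :=
  match g, r, free with
  | w :: g', a :: r', b :: free' =>
    if (if a then if b then f w (catrev pre (false :: free')) else false
        else false) then true
    else pick f (b :: pre) r' free' g'
  | _, _, _ => false
  end.

(** Depth-first search for a path from a vertex with row [r] to a vertex with
    row [t], through exactly [n.+1] distinct vertices of [free]. *)
Fixpoint link (g : table) (n : nat) (t r free : bitseq) : bool :=
  match n with
  | 0 => meet r free t
  | m.+1 => pick (link g m t) [::] r free g
  end.

(** Whether adding the edge [u v] to [g] closes a cycle of length [n], for
    [3 <= n]: the search is for a path of [n - 2] inner vertices from [u] to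
    [v]. *)
Definition closes (n : nat) (g : table) (u v : nat) : bool :=
  link g (n - 3) (row g v) (row g u) (put false (put false (nseq 10 true) u) v).

Fixpoint sublists (T : Type) (k : nat) (s : seq T) : seq (seq T) :=
  match k, s with
  | 0, _ => [:: [::]]
  | _, [::] => [::]
  | j.+1, x :: s' => map (cons x) (sublists j s') ++ sublists k s'
  end.

Definition spanned (g : table) (I : seq nat) (u v : nat) : bool :=
  (u == v) ||
  link g (size I - 3) (row g v) (row g u)
    (put false (put false (mkseq (fun i => i \in I) 10) u) v).

(** By Ore's theorem the degree condition already implies that the seven
    vertices induce a Hamilton-connected graph.  Here it serves as a cheap
    filter, and the 21 paths are then searched for. *)
Definition connects (g : table) (I : seq nat) : bool :=
  if all (fun i => 3 < count (nth false (row g i)) I) I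
  then all (fun u => all (spanned g I u) I) I else false.

(** Only vertices of degree at least 4 can lie in a set accepted by
    [connects]. *)
Definition has_hc7 (g : table) : bool :=
  has (connects g)
      (sublists 7 [seq i <- iota 0 10 | 3 < count id (row g i)]).

(** * Searching through the extensions of a partial coloring *)

(** An edge together with the colors it may have. *)
Definition step := (nat * nat * seq bool)%type.

Section Search.

Variable stop : state -> bool -> nat -> nat -> bool.

(** The plan is static.  Running out of edges counts as failure: every branch
    must reach a partial coloring accepted by [stop]. *)
Fixpoint search (plan : seq step) (st : state) : bool :=
  if plan is (u, v, colors) :: plan' then
    all (fun b =>
           let st' := add st b u v in
           if stop st' b u v then true else search plan' st') colors
  else false.

End Search.

Definition planned (known : seq (nat * nat * bool)) (order : seq (nat * nat)) :
    seq step :=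
  [seq (e.1, [:: e.2]) | e <- known] ++
  [seq (e, [:: true; false]) | e <- order].

Definition valid_pair (e : nat * nat) : bool :=
  [&& e.1 < 10, e.2 < 10 & e.1 != e.2].

(** * Soundness of the search *)

Section Sound.

Variables (T : finType) (c : coloring T) (x : nat -> T).
Hypothesis x_inj : {in gtn 10 &, injective x}.

Definition colored (b : bool) : rel T := [rel y z | c [set y; z] == b].

Lemma colored_sym b : symmetric (colored b).
Proof. by move=> y z; rewrite /colored /= setUC. Qed.

(** The vertex [x i] of the colored graph plays the role of the label [i]. *)
Definition models (st : state) : Prop :=
  forall b i j, nth false (row (side st b) i) j -> colored b (x i) (x j).

Lemma nth_putT r v j : nth false (put true r v) j = (j == v) || nth false r j.
Proof. by rewrite /put nth_set_nth /=; case: eqP. Qed.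

Lemma nth_putF r v j :
  nth false (put false r v) j = (j != v) && nth false r j.
Proof. by rewrite /put nth_set_nth /=; case: eqP. Qed.

Lemma row_insert g u v i j :
  nth false (row (insert g u v) i) j ->
  [|| nth false (row g i) j, (i == u) && (j == v) | (i == v) && (j == u)].
Proof.
rewrite /insert /row !nth_set_nth /=; case: (i =P v) => [-> | _].
  rewrite nth_putT; case: (v =P u) => [-> | _]; last first.
    by case/orP=> [->|->]; rewrite ?orbT.
  by rewrite nth_putT orbA orbb => /orP[->|->]; rewrite ?orbT.
rewrite nth_set_nth /=; case: (i =P u) => [-> | _]; last by move->.
by rewrite nth_putT => /orP[->|->]; rewrite ?orbT.
Qed.

Lemma models_blank : models blank.
Proof. by move=> [] i j; rewrite /row nth_nil nth_nil. Qed.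

Lemma models_add st b u v :
  models st -> colored b (x u) (x v) -> models (add st b u v).
Proof.
move=> st_ok uv b' i j; have [-> | neq] := eqVneq b' b; last first.
  suff ->: side (add st b u v) b' = side st b' by apply: st_ok.
  by case: b b' neq {uv} => [] [].
have ->: side (add st b u v) b = insert (side st b) u v by case: (b).
case/row_insert/or3P => [/st_ok // | /andP[/eqP-> /eqP->] // |].
by case/andP=> /eqP-> /eqP->; rewrite colored_sym.
Qed.

Lemma meetP r s t :
  meet r s t -> exists j, [/\ nth false r j, nth false s j & nth false t j].
Proof.
elim: r s t => [|a r IHr] [|b s] [|d t] //=.
case: ifP => [abd _ | _ /IHr[j jP]]; last by exists j.+1.
by exists 0; case: a b d abd => [] [] [].
Qed.

Lemma pickP f pre r free g :
  pick f pre r free g ->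
  exists j, [/\ nth false r j, nth false free j
              & f (row g j) (catrev pre (put false free j))].
Proof.
elim: g pre r free => [|w g IHg] pre [|a r] [|b free] //=.
case: ifP => [abf _ | _ /IHg[j jP]]; last by exists j.+1.
by exists 0; case: a b abf => [] [].
Qed.

(** Striking each visited vertex off [free] is what makes the path simple. *)
Lemma linkP st b n t i free :
    models st -> link (side st b) n t (row (side st b) i) free ->
  exists p : seq nat,
    [/\ size p = n.+1, uniq p, all (nth false free) p,
        path (relpre x (colored b)) i p & nth false t (last i p)].
Proof.
move=> st_ok; elim: n i free => [|n IHn] i free /=.
  case/meetP=> j [ij jf jt]; exists [:: j].
  by split; rewrite //= ?jf ?andbT //; apply: st_ok ij.
case/pickP=> j [ij jf] /= /IHn[p [sz_p Up p_free jp pt]].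
exists (j :: p); rewrite /= sz_p Up jf jp pt; split=> //.
- rewrite andbT; apply/negP=> /(allP p_free).
  by rewrite nth_putF eqxx.
- by apply: sub_all p_free => k; rewrite nth_putF => /andP[].
by rewrite andbT; apply: st_ok ij.
Qed.

Definition has_cycle (n : nat) : Prop :=
  exists b (l : seq T), [/\ size l = n, uniq l & cycle (colored b) l].

Lemma closesP n st b u v :
    2 < n -> u < 10 -> v < 10 -> u != v -> models st ->
    colored b (x u) (x v) -> closes n (side st b) u v -> has_cycle n.
Proof.
move=> n_gt2 u_lt v_lt neq_uv st_ok uv /(linkP st_ok)[p [sz_p Up p_free up pv]].
have pP i : i \in p -> [/\ i < 10, i != u & i != v].
  move/(allP p_free); rewrite !nth_putF nth_nseq.
  by case: (i < 10); case: (i != u); case: (i != v).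
exists b, (map x [:: v, u & p]); split.
- by rewrite size_map /= sz_p -[RHS](subnK n_gt2) addn3.
- rewrite map_inj_in_uniq => [|i j]; last first.
    rewrite !inE => i_in j_in; apply: x_inj; rewrite inE.
      by case/or3P: i_in => [/eqP->|/eqP->|/pP[]].
    by case/or3P: j_in => [/eqP->|/eqP->|/pP[]].
  rewrite /= Up inE negb_or eq_sym neq_uv andbT /=.
  by apply/andP; split; apply/negP=> /pP[]; rewrite eqxx.
rewrite cycle_map /= rcons_path up colored_sym uv /= colored_sym.
exact: st_ok pv.
Qed.

Definition spans (b : bool) (S : seq T) (y z : T) : Prop :=
  exists p : seq T, [/\ path (colored b) y p, last y p = z, uniq (y :: p)
                      & y :: p =i S].

Definition has_hamilton_connected (n : nat) : Prop :=
  exists b (S : seq T),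
    [/\ size S = n, uniq S & {in S &, forall y z, y != z -> spans b S y z}].

Lemma spannedP st b I u v :
    2 < size I -> uniq I -> all (gtn 10) I -> u \in I -> v \in I -> u != v ->
    models st -> spanned (side st b) I u v ->
  spans b (map x I) (x u) (x v).
Proof.
move=> I_gt2 UI I_lt uI vI neq_uv st_ok; rewrite /spanned (negPf neq_uv) /=.
case/(linkP st_ok)=> p [sz_p Up p_free up pv].
have pP i : i \in p -> [/\ i \in I, i != u & i != v].
  move/(allP p_free); rewrite !nth_putF; have [i_lt | i_ge] := ltnP i 10.
    by rewrite nth_mkseq // andbCA => /and3P[].
  by rewrite [nth _ (mkseq _ _) _]nth_default ?size_mkseq // !andbF.
have Uq : uniq (u :: rcons p v).
  rewrite /= mem_rcons inE negb_or neq_uv rcons_uniq Up andbT /=.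
  by apply/andP; split; apply/negP=> /pP[]; rewrite eqxx.
have qI : u :: rcons p v =i I.
  apply: (uniq_min_size Uq _ _).2 => [i|].
    by rewrite inE mem_rcons inE => /or3P[/eqP->|/eqP->|/pP[]].
  by rewrite /= size_rcons sz_p -[leqLHS](subnK I_gt2) addn3.
exists (map x (rcons p v)); split.
- by rewrite path_map rcons_path up /= colored_sym; apply: st_ok pv.
- by rewrite last_map last_rcons.
- rewrite -map_cons map_inj_in_uniq // => i j; rewrite !qI => iI jI.
  by apply: x_inj; [exact: (allP I_lt) iI | exact: (allP I_lt) jI].
by rewrite -map_cons; apply: eq_mem_map.
Qed.

Lemma connectsP st b I :
    2 < size I -> uniq I -> all (gtn 10) I -> models st ->
    connects (side st b) I -> has_hamilton_connected (size I).
Proof.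
move=> I_gt2 UI I_lt st_ok; rewrite /connects; case: ifP => // _ /allP cI.
exists b, (map x I); split; first by rewrite size_map.
  rewrite map_inj_in_uniq // => i j iI jI.
  by apply: x_inj; [exact: (allP I_lt) iI | exact: (allP I_lt) jI].
move=> _ _ /mapP[u uI ->] /mapP[v vI ->] neq.
apply: (spannedP _ _ _ uI vI _ st_ok) => //.
  by apply: contra_neq neq => ->.
exact: (allP (cI u uI)) vI.
Qed.

Lemma sublists_subseq (A : eqType) k (s t : seq A) :
  t \in sublists k s -> subseq t s /\ size t = k.
Proof.
elim: s k t => [|a s IHs] [|k] t //=; try by rewrite inE => /eqP->.
rewrite mem_cat => /orP[/mapP[t' /IHs[t's <-] ->] | /IHs[ts sz_t]].
  by rewrite /= eqxx.
by split=> //; apply: subseq_trans ts (subseq_cons s a).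
Qed.

Lemma has_hc7P st b :
  models st -> has_hc7 (side st b) -> has_hamilton_connected 7.
Proof.
move=> st_ok /hasP[I /sublists_subseq[sub_I sz_I] cI]; rewrite -sz_I.
have {}sub_I := subseq_trans sub_I (filter_subseq _ _).
apply: (connectsP _ _ _ st_ok cI); first by rewrite sz_I.
  by apply: subseq_uniq sub_I _; apply: iota_uniq.
by apply/allP=> i /(mem_subseq sub_I); rewrite mem_iota.
Qed.

(** The actual color of an edge is among those tried, so one branch of the
    search tree consists of partial colorings that agree with [c]; [stop] holds
    at its end. *)
Lemma search_sound (G : Prop) (stop : state -> bool -> nat -> nat -> bool)
    (known : seq (nat * nat * bool)) order :
    (forall st b u v, u < 10 -> v < 10 -> u != v -> models st ->
       colored b (x u) (x v) -> stop st b u v -> G) ->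
    all valid_pair (map fst known ++ order) ->
    (forall e, e \in known -> c [set x e.1.1; x e.1.2] = e.2) ->
    search stop (planned known order) blank -> G.
Proof.
move=> stopP ok_edges ok_known.
have: all (fun e : step => valid_pair e.1 && (c [set x e.1.1; x e.1.2] \in e.2))
        (planned known order).
  move: ok_edges; rewrite /planned !all_cat !all_map.
  case/andP=> known_ok order_ok.
  apply/andP; split; apply/allP=> e e_in /=.
    by rewrite inE (ok_known e e_in) eqxx andbT; apply: (allP known_ok) e_in.
  by rewrite (allP order_ok _ e_in); case: (c _).
elim: planned blank models_blank => [|[[u v] colors] plan IHplan] st st_ok //=.
case/andP=> /andP[/and3P[/= u_lt v_lt neq_uv] col_in] plan_ok.
move/allP/(_ _ col_in).
set b := c _; have uv : colored b (x u) (x v) by apply: eqxx.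
have {st_ok} st_ok := models_add st_ok uv.
by case: ifP => [stopped _ | _]; [apply: stopP stopped | apply: IHplan].
Qed.

End Sound.

(** * A monochromatic cycle on six vertices *)

Section Colorings.

Local Notation T := 'I_10.

(** Configurations are searched with labels [0], ..., [9]; a given sequence of
    vertices may be taken to have the first labels. *)
Lemma labelling (l : seq T) :
    uniq l ->
  exists2 x : nat -> T, {in gtn 10 &, injective x} & mkseq x (size l) = l.
Proof.
move=> Ul; pose s := l ++ [seq y <- enum T | y \notin l].
have Us : uniq s.
  rewrite cat_uniq Ul filter_uniq ?enum_uniq // andbT.
  by apply/hasPn=> y; rewrite mem_filter => /andP[].
have sz_s : size s = 10.
  rewrite -[RHS](card_ord 10) -(card_uniqP Us); apply: eq_card => y.
  by rewrite mem_cat mem_filter mem_enum andbT orbN.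
exists (nth ord0 s) => [i j i_lt j_lt /eqP|].
  by rewrite nth_uniq ?sz_s // => /eqP.
apply: (@eq_from_nth _ ord0); rewrite size_mkseq // => i i_lt.
by rewrite nth_mkseq // nth_cat i_lt.
Qed.

Implicit Type c : coloring T.

Definition swapped c : coloring T := fun e => ~~ c e.

Lemma colored_swapped c b : colored (swapped c) b =2 colored c (~~ b).
Proof. by move=> y z; rewrite /colored /swapped /=; case: (c _) b => [] []. Qed.

Lemma has_cycle_swapped c n : has_cycle (swapped c) n -> has_cycle c n.
Proof.
case=> b [l [sz_l Ul cl]]; exists (~~ b), l; split=> //.
by rewrite -(eq_cycle (colored_swapped c b)).
Qed.

Lemma has_hamilton_connected_swapped c n :
  has_hamilton_connected (swapped c) n -> has_hamilton_connected c n.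
Proof.
case=> b [S [sz_S US hS]]; exists (~~ b), S; split=> // y z yS zS neq.
have [p [yp lp Up pS]] := hS y z yS zS neq; exists p; split=> //.
by rewrite -(eq_path (colored_swapped c b)).
Qed.

Definition stop_at (ns : seq nat) st b u v :=
  has (fun n => closes n (side st b) u v) ns.

Lemma stop_atP c x ns st b u v :
    {in gtn 10 &, injective x} -> all (leq 3) ns ->
    u < 10 -> v < 10 -> u != v -> models c x st -> colored c b (x u) (x v) ->
  stop_at ns st b u v -> exists2 n, n \in ns & has_cycle c n.
Proof.
move=> x_inj ns_gt2 u_lt v_lt neq st_ok uv /hasP[n n_in cn]; exists n => //.
exact: closesP (allP ns_gt2 _ n_in) u_lt v_lt neq st_ok uv cn.
Qed.

(* The order of the edges matters only for the size of the search tree.  This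
   one and those below come from a random local search for small trees. *)
Definition order6 : seq (nat * nat) :=
  [:: (4, 6); (2, 6); (5, 6); (2, 7); (2, 5); (4, 7); (3, 7); (4, 5); (3, 6);
      (3, 4); (2, 3); (1, 7); (1, 5); (1, 4); (1, 2); (5, 7); (1, 3); (1, 6);
      (2, 4)].

Definition known6 : seq (nat * nat * bool) :=
  [:: (0, 1, true); (0, 2, true); (0, 3, true); (0, 4, true); (0, 5, true)].

Lemma search6 : search (stop_at [:: 6]) (planned known6 order6) blank.
Proof. by vm_compute. Qed.

Lemma cycle6_of_star c (y : T) (l : seq T) :
    size l = 5 -> uniq (y :: l) -> all (colored c true y) l -> has_cycle c 6.
Proof.
move=> sz_l Ul yl; have [x x_inj] := labelling Ul.
rewrite /= sz_l; case=> def_y def_l.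
apply: (search_sound (c := c) (x := x) _ _ _ search6) => //
  [st b u v u_lt v_lt neq st_ok uv|e].
  case/(stop_atP x_inj _ u_lt v_lt neq st_ok uv) => // n.
  by rewrite inE => /eqP->.
move: yl; rewrite -def_y -def_l /= !inE => /and5P[? ? ? ?] /andP[? _].
by do 4?[case/orP]; move=> /eqP-> /=; apply/eqP.
Qed.

Lemma has_cycle6 c : has_cycle c 6.
Proof.
pose s := [seq lift ord0 i | i <- enum 'I_9].
have Us : uniq (ord0 :: s).
  rewrite /= map_inj_uniq ?enum_uniq; last exact: lift_inj.
  rewrite andbT; apply/negP=> /mapP[i _ /eqP].
  by rewrite (negPf (neq_lift _ _)).
have star b : 5 <= count (colored c b ord0) s -> exists2 l : seq T,
    size l = 5 & uniq (ord0 :: l) && all (colored c b ord0) l.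
  rewrite -size_filter => sz; exists (take 5 (filter (colored c b ord0) s)).
    by rewrite size_take_min (minn_idPl sz).
  rewrite (subseq_uniq _ Us) /=; last first.
    by rewrite ?eqxx; apply: subseq_trans (take_subseq _ _) (filter_subseq _ _).
  by apply/allP=> z /mem_take; apply/allP; apply: filter_all.
have := count_predC (colored c true ord0) s; rewrite size_map size_enum_ord.
rewrite [X in _ + X](eq_count (a2 := colored c false ord0)); last first.
  by move=> z; rewrite /colored /=; case: (c _).
set n := count _ s => sz_s.
have [/star[l sz_l /andP[Ul cl]] | lt5] := leqP 5 n.
  exact: cycle6_of_star sz_l Ul cl.
have /star[l sz_l /andP[Ul cl]] : 5 <= count (colored c false ord0) s.
  by rewrite -(leq_add2l n) sz_s -[9]/(4 + 5) leq_add2r.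
apply: has_cycle_swapped; apply: cycle6_of_star sz_l Ul _.
by apply: sub_all cl => z; rewrite colored_swapped.
Qed.

(** The searches start from a cycle of color [true]; exchanging the colors
    covers the other case. *)
Lemma wlog_true_cycle n (G : coloring T -> Prop) c :
    (forall c', G (swapped c') -> G c') ->
    (forall c' l, size l = n -> uniq l -> cycle (colored c' true) l -> G c') ->
  has_cycle c n -> G c.
Proof.
move=> G_swapped G_true [[] [l [sz_l Ul cl]]]; first exact: G_true cl.
apply/G_swapped/(G_true _ l) => //.
by rewrite (eq_cycle (colored_swapped c true)).
Qed.

(** * A monochromatic cycle on seven vertices *)

Definition order7 : seq (nat * nat) :=
  [:: (3, 6); (1, 8); (2, 6); (2, 8); (3, 9); (2, 9); (5, 7); (4, 7); (4, 6);
      (1, 9); (7, 8); (5, 6); (4, 9); (3, 7); (0, 8); (0, 7); (8, 9); (5, 8);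
      (6, 9); (0, 6); (1, 7); (4, 8); (1, 6)].

Definition known_cycle n : seq (nat * nat * bool) :=
  [seq (i, i.+1 %% n, true) | i <- iota 0 n].

Lemma cycle_nth (A : Type) (e : rel A) (a : A) (l : seq A) i :
  cycle e l -> i < size l -> e (nth a l i) (nth a l (i.+1 %% size l)).
Proof.
case: l => // a0 l /(pathP a) path_l i_lt.
have := path_l i; rewrite size_rcons => /(_ i_lt).
rewrite -rcons_cons !nth_rcons i_lt; move: i_lt; rewrite ltnS leq_eqVlt.
case/orP=> [/eqP-> | i_lt]; first by rewrite ltnn eqxx modnn.
by rewrite i_lt modn_small.
Qed.

Lemma known_cycleP c x n e :
  cycle (colored c true) (mkseq x n) ->
  e \in known_cycle n -> c [set x e.1.1; x e.1.2] = e.2.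
Proof.
move=> cl /mapP[i]; rewrite mem_iota add0n => /andP[_ i_lt] -> /=.
have /(cycle_nth (x 0)) := cl; rewrite size_mkseq => /(_ i i_lt)/eqP.
by rewrite !nth_mkseq // ltn_mod (leq_trans _ i_lt).
Qed.

Lemma search7 :
  search (stop_at [:: 8; 7]) (planned (known_cycle 6) order7) blank.
Proof. by vm_compute. Qed.

Lemma cycle7_of_cycle6 c : has_cycle c 6 -> has_cycle c 8 \/ has_cycle c 7.
Proof.
apply: (@wlog_true_cycle 6 (fun c => has_cycle c 8 \/ has_cycle c 7)) => {c}.
  by move=> c [] /has_cycle_swapped; [left | right].
move=> c l sz_l Ul; have [x x_inj <-] := labelling Ul; rewrite sz_l => cl.
apply: (search_sound (c := c) (x := x) _ _ _ search7) => //
  [st b u v u_lt v_lt neq st_ok uv|e].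
  case/(stop_atP x_inj _ u_lt v_lt neq st_ok uv) => // n.
  by rewrite !inE => /orP[] /eqP-> ?; [left | right].
exact: (@known_cycleP c x 6 e cl).
Qed.

(** * Extending a monochromatic cycle on seven vertices *)

Definition outcome c : Prop := has_cycle c 8 \/ has_hamilton_connected c 7.

Lemma outcome_swapped c : outcome (swapped c) -> outcome c.
Proof.
by case=> [/has_cycle_swapped|/has_hamilton_connected_swapped]; [left|right].
Qed.

Definition stop_hc st b u v :=
  if closes 8 (side st b) u v then true else has_hc7 (side st b).

Lemma stop_hcP c x st b u v :
    {in gtn 10 &, injective x} ->
    u < 10 -> v < 10 -> u != v -> models c x st -> colored c b (x u) (x v) ->
  stop_hc st b u v -> outcome c.
Proof.
rewrite /stop_hc => x_inj u_lt v_lt neq st_ok uv; case: ifP => [c8 _ | _ hc].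
  by left; apply: (closesP x_inj _ u_lt v_lt neq st_ok uv c8).
by right; apply: (has_hc7P x_inj st_ok hc).
Qed.

Definition order_chord2 : seq (nat * nat) :=
  [:: (1, 7); (1, 3); (1, 8); (6, 7); (5, 9); (1, 6); (5, 8); (3, 7); (7, 9);
      (4, 8); (4, 9); (3, 5); (4, 7); (6, 9); (3, 8); (3, 9); (6, 8); (5, 7);
      (1, 4); (2, 9); (2, 8); (8, 9); (3, 6); (1, 5); (4, 6); (0, 5); (0, 3)].

Definition order_chord3 : seq (nat * nat) :=
  [:: (4, 7); (1, 4); (2, 7); (2, 6); (1, 7); (6, 7); (2, 8); (1, 8); (6, 9);
      (5, 9); (5, 8); (1, 9); (2, 9); (4, 8); (1, 5); (4, 9); (6, 8); (2, 4);
      (8, 9); (1, 6); (2, 5)].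

(** The reflection of the cycle [0], ..., [6] that fixes [0]. *)
Definition mirror (i : nat) : nat := if i < 7 then (7 - i) %% 7 else i.

(** A vertex joined to [0] and to [d] is, up to reflection, joined to [0] and
    to [7 - d].  For [d] equal to 1 or 6 its two neighbors are consecutive, and
    the known edges already close a cycle on eight vertices. *)
Definition order_chord (d : nat) : seq (nat * nat) :=
  let flip := map (fun e => (mirror e.1, mirror e.2)) in
  nth [::] [:: [::]; [::]; order_chord2; order_chord3;
               flip order_chord3; flip order_chord2; [::]] d.

Definition known_chord (d : nat) : seq (nat * nat * bool) :=
  rcons (rcons (known_cycle 7) (0, 7, true)) (d, 7, true).

Lemma search_chord :
  all (fun d => search stop_hc (planned (known_chord d) (order_chord d)) blank)
      (iota 1 6).
Proof. by vm_compute. Qed.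

(** Rotating the cycle so that one of the two neighbors comes first leaves six
    positions for the other. *)
Lemma outcome_of_chord c (l : seq T) (v w1 w2 : T) :
    size l = 7 -> uniq (v :: l) -> cycle (colored c true) l ->
    w1 \in l -> w2 \in l -> w1 != w2 ->
    c [set v; w1] = true -> c [set v; w2] = true ->
  outcome c.
Proof.
move=> sz_l /= /andP[vl Ul] cl /rot_to[i s def_s] w2_in neq cw1 cw2.
have sz_s : size (w1 :: s) = 7 by rewrite -def_s size_rot.
have{vl Ul} Us : uniq (rcons (w1 :: s) v).
  by rewrite rcons_uniq -def_s mem_rot vl rot_uniq.
have [x x_inj] := labelling Us; rewrite size_rcons sz_s.
have{cl} cl : cycle (colored c true) (w1 :: s) by rewrite -def_s rot_cycle.
have{w2_in} w2_in : w2 \in w1 :: s by rewrite -def_s mem_rot.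
rewrite mkseqS => /eqP; rewrite eqseq_rcons => /andP[/eqP def_l /eqP def_v].
move: w2_in; rewrite -def_l => /mapP[d].
rewrite mem_iota add0n => /andP[_ d_lt] def_w2.
have def_w1 : x 0 = w1 by case: def_l.
have d_in : d \in iota 1 6.
  rewrite mem_iota d_lt andbT lt0n; apply: contra_neq neq => d0.
  by rewrite def_w2 d0.
have search_d := allP search_chord d d_in.
apply: (search_sound (c := c) (x := x) _ _ _ search_d) =>
  [st b u u' u_lt u'_lt neq_u st_ok uu'||e].
- exact: stop_hcP x_inj u_lt u'_lt neq_u st_ok uu'.
- by move: d d_in {def_w2 d_lt search_d}; apply/allP; vm_compute.
rewrite /known_chord mem_rcons in_cons mem_rcons in_cons.
case/or3P=> [/eqP->|/eqP->|] /=.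
- by rewrite def_v -def_w2 setUC.
- by rewrite def_v def_w1 setUC.
by apply: (@known_cycleP c x 7) => //; rewrite def_l.
Qed.

(** Whether some vertex outside the cycle [0], ..., [6] has two neighbors on it,
    a case settled by [outcome_of_chord]. *)
Definition crowded (g : table) : bool :=
  has (fun k => 1 < count (nth false (row g k)) (iota 0 7)) (iota 7 3).

Definition stop_far st b u v :=
  if stop_hc st b u v then true else crowded (side st true).

Definition order_far : seq (nat * nat) :=
  [:: (1, 9); (5, 9); (6, 8); (0, 9); (3, 9); (4, 8); (5, 8); (0, 8); (6, 9);
      (0, 4); (2, 8); (1, 3); (2, 6); (1, 6); (3, 5); (2, 4); (0, 5); (4, 6);
      (2, 5); (0, 3); (1, 4); (3, 8); (3, 6); (1, 5)].

Definition known_far : seq (nat * nat * bool) :=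
  known_cycle 7 ++ [seq (i, 7, false) | i <- iota 1 6].

Lemma search_far : search stop_far (planned known_far order_far) blank.
Proof. by vm_compute. Qed.

Lemma stop_farP c x st b u v :
    {in gtn 10 &, injective x} -> cycle (colored c true) (mkseq x 7) ->
    u < 10 -> v < 10 -> u != v -> models c x st -> colored c b (x u) (x v) ->
  stop_far st b u v -> outcome c.
Proof.
rewrite /stop_far => x_inj cl u_lt v_lt neq st_ok uv.
case: ifP => [hc _ | _]; first exact: stop_hcP x_inj u_lt v_lt neq st_ok uv hc.
case/hasP=> k; rewrite mem_iota => /andP[k_ge k_lt]; rewrite -size_filter.
set s := filter _ _ => sz_s.
have Us : uniq s by rewrite filter_uniq ?iota_uniq.
have sP i : i < size s -> nth 0 s i < 7 /\ colored c true (x k) (x (nth 0 s i)).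
  move/(mem_nth 0); rewrite mem_filter mem_iota => /andP[ki /andP[_ i_lt]].
  by split=> //; apply: st_ok ki.
have x_eq i j : i < 10 -> j < 10 -> (x i == x j) = (i == j).
  by move=> i_lt j_lt; apply/eqP/eqP=> [/x_inj-> | ->].
have [lt0 /eqP red0] := sP 0 (ltnW sz_s); have [lt1 /eqP red1] := sP 1 sz_s.
have Ul : uniq (x k :: mkseq x 7).
  rewrite cons_uniq map_inj_in_uniq ?iota_uniq ?andbT; last first.
    move=> i j; rewrite !mem_iota => i_lt j_lt.
    by apply: x_inj; apply: ltn_trans (_ : 7 < 10).
  apply/negP=> /mapP[i]; rewrite mem_iota add0n => /andP[_ i_lt] /eqP.
  rewrite x_eq ?(ltn_trans i_lt) // => /eqP k_i.
  by rewrite k_i leqNgt i_lt in k_ge.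
apply: (outcome_of_chord _ Ul cl _ _ _ red0 red1); rewrite ?size_mkseq //.
- by apply: map_f; rewrite mem_iota.
- by apply: map_f; rewrite mem_iota.
by rewrite x_eq ?nth_uniq ?(ltn_trans lt0) ?(ltn_trans lt1) // ltnW.
Qed.

(** The edge from the outer vertex to the head of the cycle may have either
    color.  So this covers an outer vertex with at most one neighbor of color
    [true] on the cycle. *)
Lemma outcome_of_far c (l : seq T) (v : T) :
    size l = 7 -> uniq (rcons l v) -> cycle (colored c true) l ->
    all (colored c false v) (behead l) -> outcome c.
Proof.
move=> sz_l Ul; have [x x_inj] := labelling Ul; rewrite size_rcons sz_l.
rewrite mkseqS => /eqP; rewrite eqseq_rcons => /andP[/eqP <- /eqP <-] cl vl.
apply: (search_sound (c := c) (x := x) _ _ _ search_far) => //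
  [st b u u' u_lt u'_lt neq_u st_ok uu'|e].
  exact: stop_farP x_inj cl u_lt u'_lt neq_u st_ok uu'.
rewrite mem_cat => /orP[|/mapP[i i_in ->]] /=.
  exact: (@known_cycleP c x 7 e cl).
by have /eqP := allP vl _ (map_f x i_in); rewrite setUC.
Qed.

Lemma outcome_of_cycle7 c : has_cycle c 7 -> outcome c.
Proof.
apply: (@wlog_true_cycle 7 outcome) => {c}; first exact: outcome_swapped.
move=> c l sz_l Ul cl.
have [v vl] : exists v, v \notin l.
  apply/existsP; rewrite -negb_forall; apply/negP=> /forallP l_all.
  have /subset_leq_card : T \subset l by apply/subsetP=> w _.
  by rewrite card_ord (card_uniqP Ul) sz_l.
have [/hasP[w wl vw] | no_nbr] := boolP (has (fun w => c [set v; w]) l).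
- have [/hasP[w' wl' /andP[neq vw']] | /hasPn no_nbr] :=
      boolP (has (fun w' => (w' != w) && c [set v; w']) l).
    apply: (outcome_of_chord sz_l _ cl wl wl') vw vw'; rewrite ?(eq_sym w) //=.
    by rewrite vl.
  have [i s def_s] := rot_to wl.
  have Us : uniq (w :: s) by rewrite -def_s rot_uniq.
  apply: (@outcome_of_far c (w :: s) v).
  + by rewrite -def_s size_rot.
  + by rewrite rcons_uniq -def_s mem_rot vl rot_uniq.
  + by rewrite -def_s rot_cycle.
  apply/allP=> w' ws'; rewrite /colored /=.
  have: w' \in l by rewrite -(mem_rot i) def_s inE ws' orbT.
  move/no_nbr; have -> : w' != w.
    by move: Us; rewrite /= => /andP[w_s _]; apply: contraNneq w_s => <-.
  by rewrite andTb; case: (c _).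
apply: (@outcome_of_far c l v) => //; first by rewrite rcons_uniq vl.
apply/allP=> w /mem_behead wl; move/hasPn/(_ w wl): no_nbr.
by rewrite /colored /=; case: (c _).
Qed.

Lemma outcome_any c : outcome c.
Proof.
have [?|] := cycle7_of_cycle6 (has_cycle6 c); first by left.
exact: outcome_of_cycle7.
Qed.

End Colorings.

(** * From sequences of vertices to subgraphs *)

Lemma cycle_subgraph (c : coloring 'I_10) (n : nat) :
  has_cycle c n ->
  exists H : graph 'I_10,
    [/\ subgraph H (complete_graph 10), monochromatic c H
      & isomorphic (cycle_graph n) H].
Proof.
case=> b [l [sz_l Ul cl]]; pose f (i : 'I_n) := nth ord0 l i.
have f_inj : injective f.
  by move=> i j /eqP; rewrite nth_uniq ?sz_l // => /eqP/val_inj.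
have HP e : e \in [set f @: e | e : {set 'I_n} in cycle_edges n] ->
    (#|e| == 2) && (e \subset f @: [set: 'I_n]).
  case/imsetP=> e' e'_in ->; move: e'_in; rewrite inE => /andP[e2 _].
  by rewrite card_imset // e2 imsetS // subsetT.
exists (Graph HP); split.
- split; first exact: subsetT.
  by apply/subsetP=> e /HP/andP[e2 _]; rewrite inE.
- exists b => _ /imsetP[e e_in ->].
  move: e_in; rewrite inE => /andP[_ /existsP[i /eqP->]].
  rewrite imsetU !imset_set1; apply/eqP.
  by have := cycle_nth ord0 cl; rewrite sz_l => /(_ i (ltn_ord i)).
by exists f; split=> // i j _ _; apply: f_inj.
Qed.

Lemma hamilton_connected_subgraph (c : coloring 'I_10) (n : nat) :
  has_hamilton_connected c n ->
  exists H : graph 'I_10,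
    [/\ subgraph H (complete_graph 10), monochromatic c H,
        #|vertices H| = n & hamilton_connected H].
Proof.
case=> b [S [sz_S US hS]].
pose V := [set y in S].
pose E := [set e : {set 'I_10} | [&& #|e| == 2, e \subset V & c e == b]].
have HP e : e \in E -> (#|e| == 2) && (e \subset V).
  by rewrite inE => /and3P[-> ->].
exists (Graph HP); split.
- split; first exact: subsetT.
  by apply/subsetP=> e /HP/andP[e2 _]; rewrite inE.
- by exists b => e; rewrite inE => /and3P[_ _ /eqP].
- by rewrite /= cardsE (card_uniqP US).
move=> y z; rewrite !inE => yS zS neq.
have [p [yp pz Up pS]] := hS y z yS zS neq; exists p; split=> //; last first.
  by move=> t; rewrite pS inE.
have {pS} pS : {subset y :: p <= S} by move=> t; rewrite pS.
elim: p y {yS neq pz} yp Up pS => //= t p IHp y /andP[yt tp] /andP[y_tp Up] pS.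
rewrite IHp // => [|r r_in]; last by rewrite pS // inE r_in orbT.
rewrite andbT /adj inE cards2 subUset !sub1set !inE !pS ?inE ?eqxx ?orbT //.
by move: y_tp yt; rewrite inE negb_or => /andP[-> _].
Qed.

Theorem theorem8p16 (c : coloring 'I_10) :
  (~ exists H : graph 'I_10,
       [/\ subgraph H (complete_graph 10), monochromatic c H
         & isomorphic (cycle_graph 8) H]) ->
  exists H : graph 'I_10,
    [/\ subgraph H (complete_graph 10), monochromatic c H,
        #|vertices H| = 7 & hamilton_connected H].
Proof.
move=> no_C8; case: (outcome_any c) => [/cycle_subgraph // |].
exact: hamilton_connected_subgraph.
Qed.
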